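(* Let $U:\mathbb R^d\to[-\infty,\infty)$ be a utility function supported on $\mathbb R_+^d$ such that (1) $U$ is upper semi-continuous; (2) $U$ is strictly concave on $\operatorname{int}(\mathbb R_+^d)$; (3) $U$ is essentially smooth; (4) $U$ is asymptotically satiable. If $U$ is bounded from below on $\operatorname{int}(\mathbb R_+^d)$, multivariate risk averse, and has reasonable asymptotic elasticity, then $U^*$ satisfies the growth condition: there exists a function $\zeta:(0,1]\to[0,\infty)$ such that for all $\epsilon\in(0,1]$ and all $x^*\in\operatorname{int}(\mathbb R_+^d)$, $$U^*(\epsilon x^* )\le\zeta(\epsilon)\big(U^*(x^* )^++1\big).$$
   Context: For a proper concave $U:\mathbb R^d\to[-\infty,\infty)$: $\operatorname{dom}(U)=\{U>-\infty\}$ (nonempty by properness); $\operatorname{cl}(U)$ is the function whose hypograph is the closure of the hypograph of $U$; $\partial U(x)=\{x^*:U(z)\le U(x)+\langle z-x,x^*\rangle\ \forall z\}$; the dual function is $U^*(x^* )=\sup_{x\in\mathbb R^d}\{U(x)-\langle x,x^*\rangle\}$. $U$ is a utility function if $C_U:=\operatorname{cl}(\operatorname{dom}(U))$ is a convex cone with $\mathbb R_+^d\subseteq C_U\ne\mathbb R^d$ and $U(x')\ge U(x)$ whenever $x'-x\in C_U$; it is supported on $\mathbb R_+^d$ if $C_U=\mathbb R_+^d$. Essentially smooth: $\operatorname{int}(\operatorname{dom}(U))\neq\emptyset$, $U$ is differentiable on it, and $|\nabla U(x_i)|\to\infty$ whenever $(x_i)$ in $\operatorname{int}(\operatorname{dom}(U))$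 converges to a boundary point of $\operatorname{int}(\operatorname{dom}(U))$. Asymptotically satiable: for all $\epsilon>0$ there is $x\in\mathbb R^d$ with $\partial(\operatorname{cl}(U))(x)\cap[0,\epsilon)^d\neq\emptyset$. Multivariate risk averse: $U(x)+U(x+z+z')\le U(x+z)+U(x+z')$ for all $x\in\mathbb R^d$ and $z,z'\in\mathbb R_+^d$. Reasonable asymptotic elasticity (for essentially smooth $U$ supported on $\mathbb R_+^d$ and bounded from below on $\operatorname{int}(\mathbb R_+^d)$): $$\sup_{c\in\mathbb R}\ \liminf_{x\in\operatorname{int}(\mathbb R_+^d),\ |x|\to\infty}\frac{U(x)+c}{\langle x,\nabla U(x)\rangle}>1,\qquad |x|:=\max\{|x_1|,\dots,|x_d|\}.$$ $a^+=\max\{a,0\}$. *)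

(* Defs.v *)
From HB Require Import structures.
From mathcomp Require Import all_boot all_order all_algebra.
From mathcomp Require Import all_classical all_reals all_analysis.

Set Implicit Arguments.
Unset Strict Implicit.
Unset Printing Implicit Defensive.

Import Order.TTheory GRing.Theory Num.Theory.
Import numFieldNormedType.Exports.

Local Open Scope classical_set_scope.
Local Open Scope ring_scope.

(* R^d is 'rV[R]_d, whose library norm is the maximum norm. A function with   *)
(* values in [-oo, +oo) is a function to \bar R that avoids +oo; this is part *)
(* of [proper] below.                                                         *)

Definition dotp (R : realType) (d : nat) (x y : 'rV[R]_d) : R :=
  \sum_(i < d) x 0 i * y 0 i.

Definition orthant (R : realType) (d : nat) : set 'rV[R]_d :=
  [set x | forall i, 0 <= x 0 i].
Arguments orthant {R d}.

Definition boundary (T : topologicalType) (A : set T) : set T :=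
  closure A `\` A°.

Definition convex_cone (R : realType) (d : nat) (K : set 'rV[R]_d) : Prop :=
  K !=set0 /\ convex_set K /\ forall t x, 0 < t -> K x -> K (t *: x).

Section ExtendedRealFunctions.
Context {R : realType} {d : nat}.
Implicit Types (U : 'rV[R]_d -> \bar R) (A : set 'rV[R]_d).

Definition edom U : set 'rV[R]_d := [set x | (-oo < U x)%E].

Definition hypograph U : set ('rV[R]_d * R) :=
  [set p | (p.2%:E <= U p.1)%E].

Definition proper U : Prop :=
  edom U !=set0 /\ forall x, (U x < +oo)%E.

Definition concave U : Prop := forall (x y : 'rV[R]_d) (t : R), 0 < t < 1 ->
  (t%:E * U x + (1 - t)%:E * U y <= U (t *: x + (1 - t) *: y)%R)%E.

Definition strictly_concave_on A U : Prop :=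
  forall (x y : 'rV[R]_d) (t : R), A x -> A y -> x != y -> 0 < t < 1 ->
  (t%:E * U x + (1 - t)%:E * U y < U (t *: x + (1 - t) *: y)%R)%E.

Definition upper_semicontinuous U : Prop := lower_semicontinuous (\- U)%E.

(* The function whose hypograph is [closure (hypograph U)]; see               *)
(* [hypograph_cl] below.                                                      *)
Definition cl U (x : 'rV[R]_d) : \bar R :=
  ereal_sup [set a%:E | a in [set a | closure (hypograph U) (x, a)]].

Definition superdifferential U (x : 'rV[R]_d) : set 'rV[R]_d :=
  [set y | forall z, (U z <= U x + (dotp (z - x)%R y)%:E)%E].

Definition dual U (y : 'rV[R]_d) : \bar R :=
  ereal_sup [set (U x - (dotp x y)%:E)%E | x in [set: 'rV[R]_d]].

Definition C_ U : set 'rV[R]_d := closure (edom U).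

Definition utility U : Prop :=
  [/\ proper U, concave U, convex_cone (C_ U),
      orthant `<=` C_ U /\ C_ U != setT &
      forall x x', C_ U (x' - x) -> (U x <= U x')%E].

Definition supported_on_orthant U : Prop := C_ U = orthant.

(* [fine] is harmless here: the gradient is only used on the interior of the  *)
(* domain, near which [U] is finite.                                          *)
Definition grad U (x : 'rV[R]_d) : 'rV[R]_d :=
  \row_i 'D_(delta_mx 0 i) (fine \o U) x.

Definition essentially_smooth U : Prop :=
  [/\ (edom U)° !=set0,
      forall x, (edom U)° x -> differentiable (fine \o U) x &
      forall (u : nat -> 'rV[R]_d) (x : 'rV[R]_d),
        (forall n, (edom U)° (u n)) -> boundary ((edom U)°) x ->
        u @ \oo --> x -> `|grad U (u n)| @[n --> \oo] --> +oo].

Definition asymptotically_satiable U : Prop :=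
  forall e : R, 0 < e -> exists x : 'rV[R]_d,
    superdifferential (cl U) x `&` [set y | forall i, 0 <= y 0 i < e] !=set0.

Definition bounded_below_on A U : Prop :=
  exists m : R, forall x, A x -> (m%:E <= U x)%E.

Definition multivariate_risk_averse U : Prop :=
  forall x z z' : 'rV[R]_d, orthant z -> orthant z' ->
    (U x + U (x + z + z')%R <= U (x + z)%R + U (x + z')%R)%E.

(* The filter "x in A, |x| --> oo".                                           *)
Definition infty_within A : set_system 'rV[R]_d :=
  filter_from [set: R] (fun M => A `&` [set x | M < `|x|]).

Definition reasonable_asymptotic_elasticity U : Prop :=
  (1 < ereal_sup [set limf_einf
         (fun x => ((fine (U x) + c) / dotp x (grad U x))%:E)
         (infty_within orthant°) | c in [set: R]])%E.

Definition growth_condition U : Prop :=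
  exists zeta : R -> R,
    (forall e, 0 < e <= 1 -> 0 <= zeta e) /\
    forall (e : R) (y : 'rV[R]_d), 0 < e <= 1 -> orthant° y ->
      (dual U (e *: y)%R <= (zeta e)%:E * (maxe (dual U y) 0 + 1))%E.

Lemma hypograph_cl U : hypograph (cl U) = closure (hypograph U).
Proof.
have down x (a b : R) : closure (hypograph U) (x, a) -> b <= a ->
    closure (hypograph U) (x, b).
  move=> cla ba B nB.
  have shift_cvg : p + (0, b - a) @[p --> (x, a)] --> (x, b).
    have -> : (x, b) = (x, a) + (0, b - a).
      by congr pair => /=; rewrite ?addr0 ?subrKC.
    by apply: cvgD; [exact: cvg_id|exact: cvg_cst].
  have [p [Up Bp]] := cla _ (shift_cvg _ nB).
  exists (p + (0, b - a)); split => //.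
  rewrite /hypograph/= addr0; apply: le_trans Up.
  by rewrite lee_fin gerDl subr_le0.
apply/seteqP; split => -[x a] /= => [|cla]; last first.
  by apply: ereal_sup_ubound; exists a.
rewrite /hypograph/= => ha.
have cle e : 0 < e -> closure (hypograph U) (x, a - e).
  move=> e0; have : ((a - e)%:E < cl U x)%E.
    by apply: lt_le_trans ha; rewrite lte_fin ltrBlDr ltrDl.
  move=> /ereal_sup_gt[_ /= [b clb <-]]; rewrite lte_fin => /ltW.
  exact: down clb.
have /closure_id -> := @closed_closure _ (hypograph U).
move=> B nB.
have sub_cvg : (x, a) - e *: (0, 1) @[e --> (0 : R)^'+] --> (x, a).
  apply: cvg_at_right_filter.
  rewrite -[X in _ --> X]subr0 -[X in _ - X](scale0r ((0, 1) : 'rV[R]_d * R)).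
  by apply: cvgB; [exact: cvg_cst|apply: cvgZr_tmp; exact: cvg_id].
have : \forall e \near (0 : R)^'+, 0 < e /\ B ((x, a) - e *: (0, 1)).
  by apply: filterI; [exact: nbhs_right_gt|exact: sub_cvg].
move=> /filter_ex[e [e0 Be]]; exists ((x, a) - e *: (0, 1)); split => //.
rewrite [X in closure _ X](_ : _ = (x, a - e)); first exact: cle.
by congr pair => /=; rewrite ?scaler0 ?subr0// [_ *: _]mulr1.
Qed.

End ExtendedRealFunctions.

(* Main.v *)
(* Let a = 1/g < 1, where g > 1 is a lower bound of the elasticity ratio at   *)
(* all large x. Along a ray that bound reads t F'(t) <= a F(t) for            *)
(* F(t) = U(tx) + c, so F(t) t^(-a) is nonincreasing and                      *)
(* U(Lx) + c <= L^a (U(x) + c) for L >= 1 and |x| large. Given e, take L with *)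
(* L^(a - 1) = e. If |x| is large, testing U^*(y) at x/L gives                *)
(* U(x) - e<x,y> <= L^a (U^*(y) + c) - c, the terms in <x,y> cancelling. If   *)
(* |x| is bounded, so is U(x), by monotonicity. Boundary points of the        *)
(* orthant are reached by shifting x inwards.                                 *)

Require Import Defs.
From mathcomp Require Import all_boot all_order all_algebra.
From mathcomp Require Import all_classical all_reals all_analysis.
From mathcomp Require Import ring lra.

Import Order.TTheory GRing.Theory Num.Theory.
Import numFieldNormedType.Exports.
Local Open Scope classical_set_scope.
Local Open Scope ring_scope.

(** Dilation by L multiplies <x,y> by L but, far out, U + c by at most L^(1/g), with 1/g < 1. This
    gap pays for the factor e in U^*(e y). [elasticity_bound] extracts c, g and M from the
    elasticity hypothesis, [powR_growth] and [elasticity_growth] integrate the resulting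
    differential inequality along rays, and [dual_scaling] bounds U(x) - e<x,y> at interior points
    by the maximum of a constant depending on e and an affine function of U^*(y). The theorem
    absorbs both into zeta(e). *)

Section DotProduct.
Context {R : realType} {d : nat}.
Implicit Types x y : 'rV[R]_d.

Lemma dotpDl x x' y : dotp (x + x') y = dotp x y + dotp x' y.
Proof.
by rewrite /dotp -big_split; apply: eq_bigr => i _; rewrite mxE mulrDl.
Qed.

Lemma dotpZl (a : R) x y : dotp (a *: x) y = a * dotp x y.
Proof.
by rewrite /dotp mulr_sumr; apply: eq_bigr => i _; rewrite mxE mulrA.
Qed.

Lemma dotpZr (a : R) x y : dotp x (a *: y) = a * dotp x y.
Proof.
by rewrite /dotp mulr_sumr; apply: eq_bigr => i _; rewrite mxE mulrCA.
Qed.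

Lemma dotp_ge0 x y : orthant x -> orthant y -> 0 <= dotp x y.
Proof. by move=> x0 y0; apply: sumr_ge0 => i _; apply: mulr_ge0. Qed.

Lemma pos_interior_orthant x : (forall i, 0 < x 0 i) -> orthant° x.
Proof.
move=> x0.
suff : \forall y \near nbhs x, forall i, 0 <= (y : 'rV[R]_d) 0 i by [].
apply: filter_forall => i.
apply: filterS (cvgr_gt (x 0 i) (@coord_continuous R 1 d 0 i x) 0 (x0 i)) => y.
exact: ltW.
Qed.

Lemma derive_gradE (U : 'rV[R]_d -> \bar R) x v :
  differentiable (fine \o U) x -> 'D_v (fine \o U) x = dotp v (grad U x).
Proof.
move=> dU; rewrite deriveE// [in LHS](row_sum_delta v) linear_sum.
by apply: eq_bigr => i _; rewrite linearZ mxE deriveE.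
Qed.

Lemma is_derive_ray (f : 'rV[R]_d -> R) x (t : R) :
  differentiable f (t *: x) ->
  is_derive t 1 (fun s => f (s *: x)) ('D_x f (t *: x)).
Proof.
move=> /(@diff_derivable _ _ _ _ _ x) df.
have E : (fun h : R => h^-1 *: (f ((h *: (1 : R) + t) *: x) - f (t *: x))) =
         (fun h : R => h^-1 *: (f (h *: x + t *: x) - f (t *: x))).
  by apply/funext => h; rewrite scalerDl [h *: 1]mulr1.
by split; [rewrite /derivable|rewrite /derive]; rewrite E.
Qed.

(** Gives the sign of <x, grad U(x)>, needed to clear that denominator. Monotonicity is assumed only
    at positive multiples of x, hence the restriction to |h| < 1. *)
Lemma derive_ray_ge0 (f : 'rV[R]_d -> R) x : differentiable f x ->
  (forall s t : R, 0 < s -> s <= t -> f (s *: x) <= f (t *: x)) ->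
  0 <= 'D_x f x.
Proof.
move=> /(@diff_derivable _ _ _ _ _ x) df mono.
apply: limr_ge => //; near=> h.
have h1 : `|h| < 1.
  near: h; apply: dnbhs0_lt; exact: ltr01.
have -> : f (h *: x + x) - f x = f ((h + 1) *: x) - f (1 *: x).
  by rewrite scalerDl !scale1r.
have := ltr_norml h 1; rewrite h1 => /esym/andP[hl hr].
have [h0|h0] := leP 0 h.
  apply: mulr_ge0; first by rewrite invr_ge0.
  by rewrite subr_ge0 mono//; lra.
apply: mulr_le0; first by rewrite invr_le0 ltW.
by rewrite subr_le0 mono//; lra.
Unshelve. all: by end_near.
Qed.

End DotProduct.

(** The derivative of F(t) t^(-a) is t^(-a-1) (t F'(t) - a F(t)) <= 0. *)
Lemma powR_growth (R : realType) (F F' : R -> R) (a L : R) : 1 <= L ->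
  (forall t : R, 1 <= t -> is_derive t 1 F (F' t)) ->
  (forall t : R, 1 <= t -> t * F' t <= a * F t) ->
  F L <= L `^ a * F 1.
Proof.
move=> L1 dF hF.
have dG (t : R) : 1 <= t -> is_derive t 1 (fun s => F s * s `^ (- a))
    (F t * (- a * t `^ (- a - 1)) + t `^ (- a) * F' t).
  move=> t1; have t0 : 0 < t by lra.
  have dFt := dF _ t1; have dp := is_derive1_powR (- a) t0.
  exact: is_deriveM.
have L0 : 0 < L by lra.
suff : F L * L `^ (- a) <= F 1 * 1 `^ (- a).
  rewrite powR1 mulr1 powRN ler_pdivrMr ?powR_gt0//.
  by rewrite mulrC.
apply: (@ler0_derive1_nincr _ (fun s => F s * s `^ (- a)) 1 L) => //.
- by move=> t; rewrite in_itv/= => /andP[/ltW/dG[]].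
- move=> t; rewrite in_itv/= => /andP[t1 _].
  rewrite derive1E; have [_ ->] := dG t (ltW t1).
  have t0 : 0 < t by lra.
  have -> : t `^ (- a) = t * t `^ (- a - 1).
    rewrite -{1}(subrK 1 (- a)) powRD ?powRr1 ?(ltW t0)//; first exact: mulrC.
    by rewrite (gt_eqF t0) implybT.
  have p0 := powR_gt0 (- a - 1) t0.
  have := hF _ (ltW t1); nra.
- apply: derivable_within_continuous => t; rewrite in_itv/= => /andP[/dG[]//].
Qed.

Lemma coord_le_norm (R : realType) (d : nat) (x : 'rV[R]_d) i : x 0 i <= `|x|.
Proof.
apply: le_trans (ler_norm _) _.
rewrite [leRHS]/Num.norm/= mx_normrE; apply/bigmax_geP; right => /=.
by exists (0, i).
Qed.

Lemma elasticity_bound (R : realType) (d : nat) (U : 'rV[R]_d -> \bar R) :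
  reasonable_asymptotic_elasticity U ->
  exists c g M : R, 1 < g /\ forall x, orthant° x -> M < `|x| ->
    g < (fine (U x) + c) / dotp x (grad U x).
Proof.
move=> /ereal_sup_gt[_ [c _ <-]]; rewrite limf_einfE.
move=> /ereal_sup_gt[_ [V [M _ MV] <-]] infV.
have [g g1 gV] : exists2 g : R, 1 < g &
    (g%:E < ereal_inf
      ((fun x => ((fine (U x) + c) / dotp x (grad U x))%:E) @` V))%E.
  (* The infimum may be +oo; then any real above 1 serves as g. *)
  move: infV; case: ereal_inf => [r|_|//].
  - rewrite lte_fin => r1; exists ((1 + r) / 2); rewrite ?lte_fin; lra.
  - by exists 2; rewrite ?ltry//; lra.
exists c, g, M; split => // x x0 Mx; rewrite -lte_fin.
by apply: lt_le_trans gV _; apply: ereal_inf_lbound; exists x => //; apply: MV.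
Qed.

Section GrowthCondition.
Context {R : realType} {d : nat} (U : 'rV[R]_d -> \bar R).
Hypothesis U_fin : forall x : 'rV[R]_d,
  (forall i, 0 < x 0 i) -> U x \is a fin_num.
Hypothesis U_mono : forall x x', orthant (x' - x) -> (U x <= U x')%E.
Hypothesis U_diff : forall x : 'rV[R]_d,
  (forall i, 0 < x 0 i) -> differentiable (fine \o U) x.

Lemma elasticity_growth (c g M : R) (x : 'rV[R]_d) (L : R) :
  1 < g ->
  (forall x, orthant° x -> M < `|x| ->
     g < (fine (U x) + c) / dotp x (grad U x)) ->
  (forall i, 0 < x 0 i) -> M < `|x| -> 0 <= M -> 1 <= L ->
  fine (U (L *: x)) + c <= L `^ g^-1 * (fine (U x) + c).
Proof.
move=> g1 hg x0 Mx M0 L1.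
have pos (t : R) i : 1 <= t -> 0 < (t *: x) 0 i.
  by move=> t1; rewrite mxE mulr_gt0//; lra.
have -> : fine (U x) = fine (U (1 *: x)) by rewrite scale1r.
apply: (@powR_growth _ (fun t => fine (U (t *: x)) + c)
  (fun t => 'D_x (fine \o U) (t *: x))) => // t t1.
  rewrite -[X in is_derive _ _ _ X]addr0; apply: is_deriveD.
  by apply: is_derive_ray; apply: U_diff => i; exact: pos.
have t0 : 0 < t by lra.
have dUt : differentiable (fine \o U) (t *: x).
  by apply: U_diff => i; exact: pos.
have DE : t * 'D_x (fine \o U) (t *: x) = dotp (t *: x) (grad U (t *: x)).
  by rewrite derive_gradE// dotpZl.
have D0 : 0 <= dotp (t *: x) (grad U (t *: x)).
  rewrite -derive_gradE//; apply: derive_ray_ge0 => // s r s0 sr.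
  have sr_pos (q : R) i : 0 < q -> 0 < (q *: (t *: x)) 0 i.
    by move=> q0; rewrite mxE mulr_gt0// pos.
  apply: fine_le; rewrite ?U_fin//; try by move=> i; apply: sr_pos => //; lra.
  apply: U_mono => i; rewrite -scalerBl mxE; apply: mulr_ge0; first lra.
  by rewrite ltW// pos.
have Mt : M < `|t *: x|.
  rewrite normrZ gtr0_norm//; apply: lt_le_trans Mx _.
  by rewrite ler_peMl.
have := hg _ (pos_interior_orthant _ (fun i => pos t i t1)) Mt.
(* If the denominator vanishes, the quotient is 0 by convention, contradicting g > 1. *)
rewrite DE; move: D0; rewrite le_eqVlt => /predU1P[<-|D0].
  by rewrite invr0 mulr0; lra.
rewrite ltr_pdivlMr// => /ltW gD.
by rewrite mulrC ler_pdivlMr ?(mulrC _ g)//; lra.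
Qed.

(** L solves L^(1/g) = e L, so that L^(1/g) <x/L, y> = e <x,y> cancels exactly. *)
Lemma dual_scaling (c g M e u : R) (y : 'rV[R]_d) (x : 'rV[R]_d) :
  let L := e^-1 `^ (1 - g^-1)^-1 in
  1 < g -> 0 <= M ->
  (forall x, orthant° x -> M < `|x| ->
     g < (fine (U x) + c) / dotp x (grad U x)) ->
  0 < e <= 1 -> orthant y -> dual U y = u%:E ->
  (forall i, 0 < x 0 i) ->
  fine (U x) - e * dotp x y <=
    Num.max (fine (U (const_mx (L * (M + 1))))) (L `^ g^-1 * (u + c) - c).
Proof.
move=> L g1 M0 hg /andP[e0 e1] y0 yu x0; rewrite le_max; apply/orP.
have xy0 : 0 <= dotp x y by apply: dotp_ge0 => // i; exact: ltW.
have gi1 : g^-1 < 1 by rewrite invf_lt1//; lra.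
have L1 : 1 <= L.
  rewrite /L -[leLHS](powRr0 e^-1) ler_powR ?invf_ge1// invr_ge0; lra.
have L0 : 0 < L by lra.
(* Below this threshold x lies under a constant vector with positive entries; above it x/L has norm
   greater than M. *)
have [xM|Mx] := leP `|x| (L * (M + 1)).
  left; apply: (@le_trans _ _ (fine (U x))).
    by rewrite gerBl mulr_ge0// ltW.
  apply: fine_le; rewrite ?U_fin//.
    by move=> i; rewrite mxE mulr_gt0//; lra.
  apply: U_mono => i; rewrite !mxE subr_ge0.
  exact: le_trans (coord_le_norm _ _ _ _) xM.
right; set z := L^-1 *: x.
have z0 i : 0 < z 0 i by rewrite mxE mulr_gt0// invr_gt0.
have xE : x = L *: z by rewrite scalerA divff ?scale1r// gt_eqF.
have Mz : M < `|z|.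
  rewrite normrZ gtr0_norm ?invr_gt0// ltr_pdivlMl//.
  by apply: lt_trans Mx; rewrite ltr_pM2l//; lra.
have Ux := elasticity_growth _ _ _ _ _ g1 hg z0 Mz M0 L1.
have Uz : fine (U z) - dotp z y <= u.
  rewrite -lee_fin EFinB fineK ?U_fin// -yu.
  by apply: ereal_sup_ubound; exists z.
have Le : L `^ g^-1 = e * L.
  rewrite -{1}(subrK 1 g^-1) powRD ?(gt_eqF L0) ?implybT// powRr1 ?ltW//.
  congr (_ * _); rewrite /L -powRrM (_ : _ * _ = -1); last by field; lra.
  by rewrite powR_inv1 ?invrK// invr_ge0 ltW.
have p0 : 0 <= L `^ g^-1 by exact: powR_ge0.
have : L `^ g^-1 * (fine (U z)) <= L `^ g^-1 * (u + dotp z y).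
  by apply: ler_wpM2l => //; lra.
have -> : L `^ g^-1 * (u + dotp z y) = L `^ g^-1 * u + e * dotp x y.
  by rewrite mulrDr {2}Le -mulrA -dotpZl -xE.
move: Ux; rewrite -xE; lra.
Qed.

End GrowthCondition.

Theorem proposition2p22 (R : realType) (d : nat) (U : 'rV[R]_d -> \bar R)
  (hU : utility U) (hsupp : supported_on_orthant U)
  (husc : upper_semicontinuous U)
  (hconc : strictly_concave_on orthant° U)
  (hsmooth : essentially_smooth U)
  (hsat : asymptotically_satiable U)
  (hbdd : bounded_below_on orthant° U)
  (hrisk : multivariate_risk_averse U)
  (hRAE : reasonable_asymptotic_elasticity U) :
  growth_condition U.
Proof.
have [[_ Ultoo] _ _ _ mono] := hU; have [m Um] := hbdd.
have {}mono x x' : orthant (x' - x) -> (U x <= U x')%E.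
  by rewrite -hsupp; exact: mono.
have Upos (x : 'rV[R]_d) : (forall i, 0 < x 0 i) -> U x \is a fin_num.
  move=> /pos_interior_orthant/Um mU; rewrite fin_numE -ltey Ultoo andbT.
  by rewrite -ltNye (lt_le_trans _ mU)// ltNyr.
have Udiff (x : 'rV[R]_d) :
    (forall i, 0 < x 0 i) -> differentiable (fine \o U) x.
  move=> /pos_interior_orthant xo; have [_ + _] := hsmooth; apply.
  apply: filterS (nbhs_interior xo) => z /Um; apply: lt_le_trans.
  exact: ltNyr.
have [c [g [M0 [g1 hg0]]]] := elasticity_bound _ _ _ hRAE.
pose M := Num.max M0 0.
have hg x : orthant° x -> M < `|x| -> g < (fine (U x) + c) / dotp x (grad U x).
  by move=> xo; rewrite gt_max => /andP[Mx _]; exact: hg0.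
have M_ge0 : 0 <= M by rewrite le_max lexx orbT.
pose L (e : R) := e^-1 `^ (1 - g^-1)^-1.
pose K e := fine (U (const_mx (L e * (M + 1)))).
(* The last summand makes zeta(e) positive, so zeta(e) times +oo is +oo when U^*(y) = +oo. *)
pose zeta e := L e `^ g^-1 * (1 + `|c|) + `|c| + `|K e| + 1.
have zeta_gt0 e : 0 < zeta e.
  by rewrite ltr_wpDl// !addr_ge0// mulr_ge0 ?powR_ge0// addr_ge0.
exists zeta; split=> [e _|e y e01 y0]; first exact: ltW.
have {}y0 : orthant y by exact: interior_subset.
have [e0 e1] := andP e01.
pose o : 'rV[R]_d := const_mx 1.
have one_pos i : 0 < o 0 i by rewrite mxE.
have dual_ge : (U o - (dotp o y)%:E <= dual U y)%E.
  by apply: ereal_sup_ubound; exists o.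
(* A finite lower bound at the all-ones vector excludes U^*(y) = -oo. *)
move: dual_ge; rewrite -(fineK (Upos _ one_pos)).
case yu : (dual U y) => [u| |] // _; last first.
  by rewrite max_l ?leey// addye// gt0_muley ?lte_fin// leey.
have bound (x : 'rV[R]_d) : (forall i, 0 < x 0 i) ->
    fine (U x) - e * dotp x y <= zeta e * (Num.max u 0 + 1).
  move=> x0; apply: (le_trans (dual_scaling _ Upos mono Udiff _ _ _ _ _ _ _
    g1 M_ge0 hg e01 y0 yu x0)).
  rewrite -/(L e) -/(K e) /zeta.
  have u0 : 0 <= Num.max u 0 by rewrite le_max lexx orbT.
  have uu : u <= Num.max u 0 by rewrite le_max lexx.
  set v := Num.max u 0 in u0 uu *; set p := L e `^ g^-1.
  have p0 : 0 <= p by exact: powR_ge0.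
  have Kl := ler_norm (K e); have cl := ler_norm c; have cl' := ler_norm (- c).
  rewrite normrN in cl'; have K0 := normr_ge0 (K e); have c0 := normr_ge0 c.
  have pv := mulr_ge0 p0 u0; have pc := mulr_ge0 p0 c0.
  have pcv := mulr_ge0 pc u0.
  have Kv := mulr_ge0 K0 u0; have cv := mulr_ge0 c0 u0.
  have pu := ler_wpM2l p0 uu; have pcl := ler_wpM2l p0 cl.
  rewrite ge_max; apply/andP; split; nra.
apply: ge_ereal_sup => _ [x _ <-].
rewrite -EFin_max -EFinD -EFinM.
have [xo|nxo] := pselect (orthant x); last first.
  have -> : U x = -oo%E.
    apply/eqP; rewrite -leeNy_eq leNgt; apply/negP => Ux; apply: nxo.
    by rewrite -hsupp; exact: subset_closure.
  by rewrite addNye leNye.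
have UxltE : U x = -oo%E \/ U x \is a fin_num.
  by have := Ultoo x; case: (U x) => [r| |] //; [right|left].
have [->|Ux] := UxltE; first by rewrite addNye leNye.
rewrite -(fineK Ux) -EFinB lee_fin dotpZr.
set b := zeta e * _.
have y1 : 0 <= dotp o y by apply: dotp_ge0 => // i; exact: ltW.
apply/ler_addgt0Pr => r r0.
(* Shifting x by s(1,...,1) makes it interior without lowering U, and raises e<x,y> by at most r.
   The 1 in the denominator avoids division by zero. *)
pose s := r / (e * dotp o y + 1).
have den0 : 0 < e * dotp o y + 1 by rewrite ltr_wpDl// mulr_ge0// ltW.
have s0 : 0 < s by rewrite divr_gt0.
have xs i : 0 < (x + s *: o) 0 i by rewrite !mxE mulr1 ltr_wpDl.
have Uxs : fine (U x) <= fine (U (x + s *: o)).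
  apply: fine_le => //; first exact: Upos.
  by apply: mono => i; rewrite addrAC subrr add0r !mxE mulr1 ltW.
have := bound _ xs; rewrite dotpDl dotpZl -/b.
have : s * (e * dotp o y) <= r.
  rewrite /s mulrAC ler_pdivrMr// ler_pM2l//; lra.
by lra.
Qed.
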